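(* Let $X$ and $Y$ be real Banach spaces, let $N$ be an absolute normalized norm on $\mathbb{R}^2$, and let $\gamma>0$ be such that $\|(a,b)\|_\infty \geq \gamma N(a,b)$ for all $(a,b)\in\mathbb{R}^2$. If $X$ and $Y$ are $\delta$-average rough for some $\delta>0$, then $X\oplus_N Y$ is $\gamma\delta$-average rough.
   Context: For a Banach space $X$, $S_X$ denotes its unit sphere. For $\delta>0$, a Banach space $X$ is $\delta$-average rough if, whenever $n\in\mathbb{N}$ ($n\ge 1$) and $x_1,\dots,x_n\in S_X$, $$\limsup_{\|y\|\to 0}\frac1n\sum_{i=1}^n\frac{\|x_i+y\|+\|x_i-y\|-2}{\|y\|}\geq\delta,$$ where $y$ ranges over nonzero elements of $X$. A norm $N$ on $\mathbb{R}^2$ is absolute if $N(a,b)=N(|a|,|b|)$ for all $(a,b)\in\mathbb{R}^2$, and normalized if $N(1,0)=N(0,1)=1$. $X\oplus_N Y$ is the product space $X\times Y$ with the norm $\|(x,y)\|_N=N(\|x\|,\|y\|)$. $\|(a,b)\|_\infty=\max\{|a|,|b|\}$. *)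

(* Defs.v *)
From HB Require Import structures.
From mathcomp Require Import all_boot all_order all_algebra.
From mathcomp Require Import all_classical all_reals all_analysis.
From mathcomp Require Import ring lra.
Import Order.TTheory GRing.Theory Num.Theory.
Import numFieldNormedType.Exports.

Set Implicit Arguments.
Unset Strict Implicit.
Unset Printing Implicit Defensive.

Local Open Scope classical_set_scope.
Local Open Scope ring_scope.

(* [0^'] is the filter of punctured neighborhoods of [0], so the limit
   superior is over [y != 0].  On the zero space the quantification over unit
   vectors is vacuous, hence the space is average rough, as on paper. *)
Definition average_rough (R : realType) (delta : R)
    (X : completeNormedModType R) : Prop :=
  forall (n : nat) (x : 'I_n -> X), (0 < n)%N -> (forall i, `|x i| = 1) ->
  let quotient (y : X) : R :=
    n%:R^-1 * \sum_(i < n) ((`|x i + y| + `|x i - y| - 2) / `|y|) in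
  (delta%:E <= limf_esup (fun y => (quotient y)%:E) (0%R : X)^')%E.

Record absNormalizedNorm (R : realType) := AbsNormalizedNorm {
  absnorm_fun :> R -> R -> R;
  ler_absnormD : forall a b c d,
    absnorm_fun (a + c) (b + d) <= absnorm_fun a b + absnorm_fun c d;
  absnormZ : forall t a b,
    absnorm_fun (t * a) (t * b) = `|t| * absnorm_fun a b;
  absnorm0_eq0 : forall a b, absnorm_fun a b = 0 -> a = 0 /\ b = 0;
  absnorm_norm : forall a b, absnorm_fun a b = absnorm_fun `|a| `|b|;
  absnorm10 : absnorm_fun 1 0 = 1;
  absnorm01 : absnorm_fun 0 1 = 1 }.

Section absnorm_theory.
Variables (R : realType) (N : absNormalizedNorm R).
Implicit Types a b c d : R.

Lemma absnormN1 a b : N (- a) b = N a b.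
Proof. by rewrite absnorm_norm normrN -absnorm_norm. Qed.

Lemma absnormN2 a b : N a (- b) = N a b.
Proof. by rewrite absnorm_norm normrN -absnorm_norm. Qed.

Lemma absnorm_r0 a : N a 0 = `|a|.
Proof. by have := absnormZ N a 1 0; rewrite mulr1 mulr0 absnorm10 mulr1. Qed.

Lemma absnorm_0r b : N 0 b = `|b|.
Proof. by have := absnormZ N b 0 1; rewrite mulr1 mulr0 absnorm01 mulr1. Qed.

Lemma absnorm_mono1 a b c : 0 <= a -> a <= c -> N a b <= N c b.
Proof.
move=> a0 ac; have [c0|c0] := eqVneq c 0.
  by have -> : a = c by apply/eqP; rewrite eq_le ac c0 a0.
have cp : 0 < c by rewrite lt_neqAle eq_sym c0 (le_trans a0).
pose t := a / c.
have t0 : 0 <= t by rewrite divr_ge0// ltW.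
have t1 : t <= 1 by rewrite ler_pdivrMr// mul1r.
have h1 : 0 <= (1 + t) / 2 by lra.
have h2 : 0 <= (1 - t) / 2 by lra.
have ta : a = t * c by rewrite /t divfK.
have -> : a = (1 + t) / 2 * c + (1 - t) / 2 * - c by rewrite ta; field.
have {1}-> : b = (1 + t) / 2 * b + (1 - t) / 2 * b by field.
apply: le_trans (ler_absnormD N _ _ _ _) _.
rewrite !absnormZ absnormN1 (ger0_norm h1) (ger0_norm h2) -mulrDl.
by rewrite [X in X * _](_ : _ = 1) ?mul1r//; field.
Qed.

Lemma absnorm_mono2 a b d : 0 <= b -> b <= d -> N a b <= N a d.
Proof.
move=> b0 bd; have [d0|d0] := eqVneq d 0.
  by have -> : b = d by apply/eqP; rewrite eq_le bd d0 b0.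
have dp : 0 < d by rewrite lt_neqAle eq_sym d0 (le_trans b0).
pose t := b / d.
have t0 : 0 <= t by rewrite divr_ge0// ltW.
have t1 : t <= 1 by rewrite ler_pdivrMr// mul1r.
have h1 : 0 <= (1 + t) / 2 by lra.
have h2 : 0 <= (1 - t) / 2 by lra.
have tb : b = t * d by rewrite /t divfK.
have -> : b = (1 + t) / 2 * d + (1 - t) / 2 * - d by rewrite tb; field.
have {1}-> : a = (1 + t) / 2 * a + (1 - t) / 2 * a by field.
apply: le_trans (ler_absnormD N _ _ _ _) _.
rewrite !absnormZ absnormN2 (ger0_norm h1) (ger0_norm h2) -mulrDl.
by rewrite [X in X * _](_ : _ = 1) ?mul1r//; field.
Qed.

Lemma absnorm_mono a b c d : 0 <= a -> a <= c -> 0 <= b -> b <= d ->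
  N a b <= N c d.
Proof.
by move=> a0 ac b0 bd; apply: le_trans (absnorm_mono1 _ a0 ac) (absnorm_mono2 _ _ _).
Qed.

Lemma ler_absnorm_sum a b : N a b <= `|a| + `|b|.
Proof.
rewrite -absnorm_r0 -absnorm_0r -{1}[a]addr0 -{1}[b]add0r.
exact: ler_absnormD.
Qed.

Lemma absnorm_ge1 a b : `|a| <= N a b.
Proof.
by rewrite -absnorm_r0 [N a b]absnorm_norm [N a 0]absnorm_norm normr0 absnorm_mono2.
Qed.

Lemma absnorm_ge2 a b : `|b| <= N a b.
Proof.
by rewrite -absnorm_0r [N a b]absnorm_norm [N 0 b]absnorm_norm normr0 absnorm_mono1.
Qed.

End absnorm_theory.

(* An alias of [X * Y], which the library already equips with the max norm. *)
Definition absum (R : realType) (N : absNormalizedNorm R)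
  (X Y : completeNormedModType R) : Type := (X * Y)%type.

Section absum_instances.
Variables (R : realType) (N : absNormalizedNorm R).
Variables (X Y : completeNormedModType R).
Local Notation Z := (absum N X Y).

HB.instance Definition _ := GRing.Lmodule.copy Z (X * Y)%type.

Definition absum_norm (p : Z) : R := N `|p.1| `|p.2|.

Fact ler_absum_normD (p q : Z) :
  absum_norm (p + q) <= absum_norm p + absum_norm q.
Proof.
apply: le_trans (ler_absnormD N _ _ _ _).
by apply: absnorm_mono => //; exact: ler_normD.
Qed.

Fact absum_normZ (l : R) (p : Z) : absum_norm (l *: p) = `|l| * absum_norm p.
Proof. by rewrite /absum_norm !normrZ absnormZ normr_id. Qed.

Fact absum_norm0_eq0 (p : Z) : absum_norm p = 0 -> p = 0.
Proof.
by case: p => x y /absnorm0_eq0[/= /normr0_eq0 -> /normr0_eq0 ->].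
Qed.

HB.instance Definition _ :=
  Lmodule_isNormed.Build R Z ler_absum_normD absum_normZ absum_norm0_eq0.

Lemma absum_normE (p : Z) : `|p| = N `|p.1| `|p.2|.
Proof. by []. Qed.

Fact absum_complete (F : set_system Z) :
  ProperFilter F -> cauchy F -> cvg F.
Proof.
move=> FF Fc.
have ball_fst (p q : Z) e : ball p e q -> ball p.1 e q.1.
  rewrite -!ball_normE /= absum_normE; apply: le_lt_trans.
  by rewrite -{1}normr_id; exact: absnorm_ge1.
have ball_snd (p q : Z) e : ball p e q -> ball p.2 e q.2.
  rewrite -!ball_normE /= absum_normE; apply: le_lt_trans.
  by rewrite -{1}normr_id; exact: absnorm_ge2.
move/cauchyP in Fc.
have c1 : cvg ((fun p : Z => p.1) @ F).
  apply/cauchy_cvgP/cauchyP => e e0; have [p Fp] := Fc _ e0.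
  exists p.1; rewrite /= nbhs_simpl /=.
  by apply: (filterS _ Fp) => q; exact: ball_fst.
have c2 : cvg ((fun p : Z => p.2) @ F).
  apply/cauchy_cvgP/cauchyP => e e0; have [p Fp] := Fc _ e0.
  exists p.2; rewrite /= nbhs_simpl /=.
  by apply: (filterS _ Fp) => q; exact: ball_snd.
pose l : Z := (lim ((fun p : Z => p.1) @ F), lim ((fun p : Z => p.2) @ F)).
apply/cvg_ex; exists l; apply/cvgrPdist_lt => e e0.
have e20 : 0 < e / 2 by rewrite divr_gt0.
near=> p.
rewrite absum_normE; apply: le_lt_trans (ler_absnorm_sum N _ _) _.
rewrite !normr_id (splitr e) /l /=; apply: ltrD; near: p.
  by have /cvgrPdist_lt/(_ _ e20) := c1.
by have /cvgrPdist_lt/(_ _ e20) := c2.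
Unshelve. all: by end_near. Qed.

HB.instance Definition _ := Uniform_isComplete.Build Z absum_complete.

End absum_instances.

(* Main.v *)
Require Import Defs.
From mathcomp Require Import all_boot all_order all_algebra.
From mathcomp Require Import all_classical all_reals all_analysis.
From mathcomp Require Import ring lra.
Import Order.TTheory GRing.Theory Num.Theory.
Import numFieldNormedType.Exports.
Local Open Scope ring_scope.

(** The quantity [spread x u] measures how much the norm bends at [x] in the direction [u].  Each point
[z i = (x i, y i)] of the unit sphere of the sum has a supporting functional of
[N] at [(`|x i|, `|y i|)]: nonnegative [c i] and [d i] with
[c i * `|x i| + d i * `|y i| = 1] and [c i * s + d i * t <= N s t] for
nonnegative [s], [t] ([absnorm_support]).  Evaluating it at the norms of the
components of [z i + (u, v)] and [z i - (u, v)] gives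
[c i * spread (x i) u + d i * spread (y i) v <= spread (z i) (u, v)].

It remains to choose one [u] that works for all [x i] at once, counted with the
weights [c i], and likewise one [v] for the [y i] with the weights [d i].  This
is [weighted_direction]: average roughness handles real weights, because integer
weights are repetitions of vectors and real weights are approximated by
multiples of a small unit.  The vectors [x i] only have norm at most [1], but shrinking a
vector towards [0] along its ray can only increase its spread
([spread_antimono]).  The same fact shows that a good direction remains good when
it is lengthened, so [u] and [v] can be found at a common prescribed scale [r].

Adding up, the total spread at [(u, v)] is at least
[e * r * \sum_i (c i + d i)] for any prescribed [e] with [0 < e < delta].
Since [`|x i|] and [`|y i|] are at most [1], each [c i + d i] is at least [1],
while [`|(u, v)| <= r * N 1 1 <= r / gamma].  Dividing yields the constant
[gamma * delta]. *)

(** * Second differences of the norm *)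

Section Spread.
Context {R : realType} {X : normedModType R}.
Implicit Types (x u : X) (t : R).

Definition spread x u : R := `|x + u| + `|x - u| - 2 * `|x|.

Lemma spread_ge0 x u : 0 <= spread x u.
Proof.
rewrite /spread subr_ge0 -[2]ger0_norm// -normrZ.
rewrite (_ : 2 *: x = (x + u) + (x - u)); first exact: ler_normD.
by rewrite addrACA subrr addr0 scaler_nat.
Qed.

Lemma spread_x0 x : spread x 0 = 0.
Proof. by rewrite /spread subr0 addr0; ring. Qed.

Lemma spreadZ t x u : 0 <= t -> spread (t *: x) (t *: u) = t * spread x u.
Proof.
by move=> t0; rewrite /spread -scalerDr -scalerBr !normrZ ger0_norm//; ring.
Qed.

(** Lengthening [x] to [t *: x] raises each of [`|x + u|] and [`|x - u|] by at
most [(t - 1) * `|x|], and raises [2 * `|x|] by exactly twice that amount. *)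
Lemma spread_antimono t x u : 1 <= t -> spread (t *: x) u <= spread x u.
Proof.
move=> t1.
have step v : `|t *: x + v| <= `|x + v| + (t - 1) * `|x|.
  rewrite (_ : t *: x + v = (x + v) + (t - 1) *: x); last first.
    by rewrite scalerBl scale1r [x + v]addrC -addrA [x + _]addrC subrK addrC.
  by rewrite (le_trans (ler_normD _ _))// normrZ ger0_norm// subr_ge0.
have t0 : 0 <= t by apply: le_trans t1.
rewrite /spread normrZ (ger0_norm t0).
have := step u; have := step (- u); lra.
Qed.

(** Convexity of the norm along the line through [x] directed by [u], obtained
here by comparing [x] with [t *: x]. *)
Lemma spread_scale t x u : 1 <= t -> t * spread x u <= spread x (t *: u).
Proof.
move=> t1; rewrite -spreadZ ?(le_trans _ t1)//.
exact: spread_antimono.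
Qed.

End Spread.

(** * Weighted average roughness *)

(** The form in which the limit superior is used: a direction of arbitrarily
small norm, with the division by [n] and by [`|y|] cleared. *)
Lemma average_roughP (R : realType) (delta : R) (X : completeNormedModType R) :
  average_rough delta X <->
  forall (n : nat) (x : 'I_n -> X), (0 < n)%N -> (forall i, `|x i| = 1) ->
  forall e r : R, e < delta -> 0 < r ->
  exists y : X, [/\ y != 0, `|y| < r &
    n%:R * e * `|y| < \sum_(i < n) spread (x i) y].
Proof.
have quotE (n : nat) (x : 'I_n -> X) (e : R) (y : X) :
    (0 < n)%N -> (forall i, `|x i| = 1) -> y != 0 ->
  (e < n%:R^-1 * \sum_(i < n) ((`|x i + y| + `|x i - y| - 2) / `|y|)) =
  (n%:R * e * `|y| < \sum_(i < n) spread (x i) y).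
  move=> n0 x1 y0; rewrite -mulr_suml ltr_pdivlMl ?ltr0n//.
  rewrite ltr_pdivlMr ?normr_gt0//; congr (_ < _).
  by apply: eq_bigr => i _; rewrite /spread x1 mulr1.
split=> rX n x n0 x1.
  move=> e r ed r0; have /= := rX n x n0 x1; rewrite limf_esupE => dle.
  have A0 : ((0 : X)^')%classic (fun y : X => y != 0 /\ `|y| < r).
    rewrite /dnbhs/= /within/=; apply/nbhs_ballP; exists r => //= y.
    by rewrite -ball_normE /= sub0r normrN.
  have : (e%:E < ereal_sup [set (n%:R^-1 * \sum_(i < n)
      ((`|x i + y| + `|x i - y| - 2) / `|y|))%:E | y in
      [set y : X | y != 0%R /\ (`|y| < r)%R]])%E.
    apply: lt_le_trans (_ : (delta%:E <= _)%E); first by rewrite lte_fin.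
    by apply: le_trans dle _; apply: ereal_inf_lbound; eexists; first exact: A0.
  case/ereal_sup_gt => _ [y [y0 yr] <-]; rewrite lte_fin quotE// => ey.
  by exists y.
rewrite /= limf_esupE.
pose quotient y :=
  n%:R^-1 * \sum_(i < n) ((`|x i + y| + `|x i - y| - 2) / `|y|).
apply: le_ereal_inf_tmp => _ [A A0 <-].
move: A0; rewrite /dnbhs/= /within/= => /nbhs_ballP[r /= r0 rA].
apply/lee_addgt0Pr => e e0.
have [|y [y0 yr ey]] := rX n x n0 x1 (delta - e) r _ r0.
  by rewrite ltrBlDr ltrDl.
rewrite -leeBlDr// -EFinB; apply: le_trans (_ : ((quotient y)%:E <= _)%E).
  by rewrite lee_fin ltW// quotE.
apply: ereal_sup_ubound; exists y => //; apply: rA => //.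
by rewrite -ball_normE /= sub0r normrN.
Qed.

Section Directions.
Context {R : realType} {X : completeNormedModType R} {delta : R}.

(** The direction comes with the scale [r] chosen in advance: the limit superior
only provides some vector shorter than [r], which is then stretched to norm [r].
Asking for [`|u| <= r] rather than equality makes the empty list, hence the zero
space, a harmless special case. *)
Lemma rough_direction (s : seq X) (e r : R) :
  average_rough delta X ->
  all (fun x => 0 < `|x| <= 1) s -> e < delta -> 0 < r ->
  exists u : X, `|u| <= r /\ (size s)%:R * e * r <= \sum_(x <- s) spread x u.
Proof.
move=> rX s1 ed r0; have [s0|s0] := posnP (size s).
  exists 0; rewrite normr0 ltW// s0 !mul0r; split=> //.
  by apply: sumr_ge0 => x _; exact: spread_ge0.
pose xs i : X := tnth (in_tuple s) i.
have xs1 i : 0 < `|xs i| <= 1.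
  by move/allP: s1; apply; exact: mem_tnth.
have x1 i : `| `|xs i|^-1 *: xs i| = 1.
  have /andP[x0 _] := xs1 i.
  by rewrite normrZ ger0_norm ?invr_ge0// mulVf ?gt_eqF.
have [y [y0 yr ey]] := (average_roughP _ _ _).1 rX _ _ s0 x1 e r ed r0.
have yp : 0 < `|y| by rewrite normr_gt0.
pose t := r / `|y|.
have t1 : 1 <= t by rewrite ler_pdivlMr// mul1r ltW.
have t0 : 0 <= t by apply: le_trans t1.
exists (t *: y); split; first by rewrite normrZ ger0_norm// divfK ?gt_eqF.
have -> : (size s)%:R * e * r = t * ((size s)%:R * e * `|y|).
  by rewrite /t; field; rewrite gt_eqF.
apply: le_trans (ler_wpM2l t0 (ltW ey)) _.
rewrite [leRHS]big_tnth mulr_sumr; apply: ler_sum => i _.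
apply: le_trans (spread_scale _ _ _ t1) _.
have /andP[x0 x1'] := xs1 i.
by apply: spread_antimono; rewrite invf_ge1.
Qed.

(** The weights are rounded to [m i / M] for a large [M], and each [x i] is
repeated [m i] times.  The rounding loses at most [n / M] of the total weight,
which the gap between [e] and [delta] absorbs. *)
Lemma weighted_direction (n : nat) (x : 'I_n -> X) (w : 'I_n -> R) (e r : R) :
  average_rough delta X ->
  (forall i, `|x i| <= 1) -> (forall i, 0 <= w i) ->
  (forall i, x i = 0 -> w i = 0) -> 0 <= e < delta -> 0 < r ->
  exists u : X, `|u| <= r /\
    (\sum_i w i) * e * r <= \sum_i w i * spread (x i) u.
Proof.
move=> rX x1 w0 xw0 /andP[e0 ed] r0.
set W := \sum_i w i.
have W0 : 0 <= W by apply: sumr_ge0.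
move: W0; rewrite le_eqVlt => /predU1P[W0|W0].
  exists 0; rewrite normr0 ltW// -W0 !mul0r; split => //.
  by apply: sumr_ge0 => i _; rewrite mulr_ge0// spread_ge0.
have [e' ee' e'd] : exists2 e', e < e' & e' < delta.
  by exists ((e + delta) / 2); lra.
(* [M] makes [(e' - e) * M * W] exceed the rounding loss [n * e']; the [+ 1]
   keeps [M] positive when [n = 0]. *)
pose M : R := (n%:R + 1) * e' / ((e' - e) * W).
have M0 : 0 < M.
  by rewrite divr_gt0 ?mulr_gt0 ?subr_gt0// ?(le_lt_trans e0)// ltr_wpDl.
pose m i := Num.truncn (M * w i).
have mP i : (m i)%:R <= M * w i < (m i).+1%:R.
  by apply: truncn_itv; rewrite mulr_ge0// ltW.
pose s := flatten [seq nseq (m i) (x i) | i <- index_enum 'I_n].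
have s1 : all (fun x => 0 < `|x| <= 1) s.
  apply/allP => z /flatten_mapP[i _]; rewrite mem_nseq => /andP[mi /eqP->].
  rewrite x1 andbT normr_gt0; apply: contraTneq mi => /xw0 wi.
  by rewrite /m wi mulr0 truncn0.
have sums (F : X -> R) : \sum_(z <- s) F z = \sum_i (m i)%:R * F (x i).
  rewrite big_flatten big_map; apply: eq_bigr => i _.
  by rewrite big_nseq iter_addr addr0 mulr_natl.
have sizes : (size s)%:R = \sum_i (m i)%:R :> R.
  have := sums (fun=> 1); rewrite big_const_seq count_predT iter_addr addr0 => ->.
  by apply: eq_bigr => i _; rewrite mulr1.
have [u [ur su]] := rough_direction _ _ _ rX s1 e'd r0.
exists u; split=> //.
rewrite -(ler_pM2l M0); apply: (@le_trans _ _ (\sum_(z <- s) spread z u)).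
  apply: le_trans su; rewrite !mulrA ler_pM2r//.
  have : M * W - n%:R <= (size s)%:R.
    rewrite sizes /W mulr_sumr lerBlDr -[X in _ + X%:R]card_ord -sum1_card.
    rewrite natr_sum -big_split /=; apply: ler_sum => i _.
    by have /andP[_ /ltW] := mP i; rewrite -natr1.
  have e'0 : 0 < e' by apply: le_lt_trans ee'.
  move/(ler_wpM2r (ltW e'0)) => h; apply: le_trans h.
  have MW : M * W * (e' - e) = (n%:R + 1) * e'.
    by rewrite /M; field; rewrite subr_eq0 !gt_eqF.
  lra.
rewrite sums mulr_sumr; apply: ler_sum => i _; rewrite mulrA.
by apply: ler_wpM2r; [exact: spread_ge0|case/andP: (mP i)].
Qed.

End Directions.

(** * Supporting functionals of an absolute norm *)

Section SupportingFunctional.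
Context {R : realType} (N : absNormalizedNorm R).
Implicit Types a b s t p q : R.

(** Convexity of [N a] on the segment from [b - p] to [b + q], with the
denominator [p + q] cleared. *)
Lemma absnorm_three_points a b p q : 0 <= p -> 0 <= q ->
  (p + q) * N a b <= q * N a (b - p) + p * N a (b + q).
Proof.
move=> p0 q0; rewrite -[X in X * N a b]ger0_norm ?addr_ge0//.
rewrite -{2}(ger0_norm q0) -{3}(ger0_norm p0) -!absnormZ.
rewrite (_ : (p + q) * a = q * a + p * a); last by ring.
rewrite (_ : (p + q) * b = q * (b - p) + p * (b + q)); last by ring.
exact: ler_absnormD.
Qed.

(** The right derivative of the convex function [N a] at [b] is a subgradient.
Monotonicity and the triangle inequality place it between [0] and [N 0 1 = 1]. *)
Lemma absnorm_subgradient2 a b : 0 <= b ->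
  exists2 d : R, 0 <= d <= 1 & forall t, N a b + d * (t - b) <= N a t.
Proof.
move=> b0.
pose slope t := (N a (b + t) - N a b) / t.
pose S : set R := [set slope t | t in [set t | 0 < t]]%classic.
have S0 : (S !=set0)%classic by exists (slope 1); exists 1 => //=; exact: ltr01.
have Slb z : (forall t, 0 < t -> z <= slope t) -> lbound S z.
  by move=> zle _ [t t0 <-]; exact: zle.
have S_ge0 : lbound S 0.
  apply: Slb => t t0; rewrite divr_ge0 ?(ltW t0)// subr_ge0.
  by apply: absnorm_mono2 => //; rewrite lerDl ltW.
have infS t : 0 < t -> inf S <= slope t.
  by move=> t0; apply: ge_inf; [exists 0|exists t].
exists (inf S) => [|t].
  rewrite lb_le_inf//=; apply: le_trans (infS 1 ltr01) _.
  have := ler_absnormD N a b 0 1; rewrite addr0 absnorm01.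
  by rewrite /slope divr1 lerBlDl.
have [tb|bt|->] := ltgtP t b; last by rewrite subrr mulr0 addr0.
- have : (N a b - N a t) / (b - t) <= inf S.
    apply: lb_le_inf => //; apply: Slb => q q0.
    rewrite /slope ler_pdivrMr ?subr_gt0// mulrAC ler_pdivlMr//.
    have := @absnorm_three_points a b (b - t) q.
    rewrite subr_ge0 (ltW tb) (ltW q0) opprB addrCA subrr addr0 => /(_ isT isT).
    lra.
  by rewrite ler_pdivrMr ?subr_gt0//; lra.
- have := infS (t - b); rewrite subr_gt0 => /(_ bt).
  rewrite /slope addrCA subrr addr0 ler_pdivlMr ?subr_gt0//; lra.
Qed.

(** With [d] a subgradient of [N a] at [b], the coefficient of the first
coordinate is forced by the value [1] at [(a, b)], and homogeneity carries the
inequality from the line of first coordinate [a] to the whole quadrant.  On the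
axes the functional is chosen so that a vanishing coordinate has weight zero:
a zero component of a unit vector of the sum then contributes nothing, and
the other summand alone provides the bound. *)
Lemma absnorm_support a b : 0 <= a -> 0 <= b -> N a b = 1 ->
  exists p : R * R,
    [/\ 0 <= p.1, 0 <= p.2, a = 0 -> p.1 = 0, b = 0 -> p.2 = 0 &
    p.1 * a + p.2 * b = 1 /\
    forall s t, 0 <= s -> 0 <= t -> p.1 * s + p.2 * t <= N s t].
Proof.
move=> a0 b0 Nab.
have [az|an] := eqVneq a 0.
  have b1 : b = 1 by move: Nab; rewrite az absnorm_0r ger0_norm.
  exists (0, 1); split => //=.
  - by rewrite b1 => /eqP; rewrite oner_eq0.
  - split=> [|s t s0 t0]; first by rewrite b1 mul0r add0r mulr1.
    by rewrite mul0r add0r mul1r -{1}(ger0_norm t0) absnorm_ge2.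
have [bz|bn] := eqVneq b 0.
  have a1 : a = 1 by move: Nab; rewrite bz absnorm_r0 ger0_norm.
  exists (1, 0); split => //=.
  - by rewrite a1 => /eqP; rewrite oner_eq0.
  - split=> [|s t s0 t0]; first by rewrite a1 mul0r addr0 mulr1.
    by rewrite mul0r addr0 mul1r -{1}(ger0_norm s0) absnorm_ge1.
have ap : 0 < a by rewrite lt_neqAle eq_sym an.
have b1 : b <= 1 by rewrite -Nab -{1}(ger0_norm b0) absnorm_ge2.
have [d /andP[d0 d1] dP] := absnorm_subgradient2 a b b0.
exists ((1 - d * b) / a, d); split => //=.
- by rewrite divr_ge0// subr_ge0 mulr_ile1.
- by move=> az; rewrite az eqxx in an.
- by move=> bz; rewrite bz eqxx in bn.
split=> [|s t s0 t0]; first by field.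
move: s0; rewrite le_eqVlt => /predU1P[<-|sp].
  rewrite mulr0 add0r absnorm_0r ger0_norm//.
  by apply: le_trans (ler_wpM2r t0 d1) _; rewrite mul1r.
have -> : N s t = s / a * N a (t * a / s).
  rewrite -[X in X * N a _]ger0_norm ?divr_ge0 ?(ltW sp)// -absnormZ.
  by congr (N _ _); field; rewrite ?an ?gt_eqF.
apply: le_trans (ler_wpM2l _ (dP _)); last by rewrite divr_ge0// ltW.
by rewrite Nab le_eqVlt; apply/orP; left; apply/eqP; field; rewrite an gt_eqF.
Qed.

End SupportingFunctional.

(** * Roughness of absolute sums *)

Theorem theorem2p4 (R : realType) (X Y : completeNormedModType R)
    (N : absNormalizedNorm R) (gamma delta : R) :
  0 < gamma ->
  (forall a b : R, gamma * N a b <= Num.max `|a| `|b|) ->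
  0 < delta ->
  average_rough delta X -> average_rough delta Y ->
  average_rough (gamma * delta) (absum N X Y).
Proof.
move=> g0 gN d0 rX rY; apply/average_roughP => n z n0 z1 e rho ed rho0.
have N11 : N 1 1 <= gamma^-1.
  have := gN 1 1; rewrite normr1 maxxx => h.
  by rewrite -[leRHS]mul1r ler_pdivlMr// mulrC.
have N110 : 0 < N 1 1.
  by apply: lt_le_trans (absnorm_ge1 N 1 1); rewrite normr1.
(* Any [e'] between [e / gamma] and [delta] would do for the estimate; the
   maximum with [0] keeps it positive, so that the vector found is nonzero. *)
pose e' := (Num.max 0 (e / gamma) + delta) / 2.
have edg : e / gamma < delta by rewrite ltr_pdivrMr// mulrC.
have m0 : 0 <= Num.max 0 (e / gamma) by rewrite le_max lexx.
have me : e / gamma <= Num.max 0 (e / gamma) by rewrite le_max lexx orbT.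
have md : Num.max 0 (e / gamma) < delta by rewrite gt_max d0.
have e'0 : 0 < e' by rewrite /e'; lra.
have e'd : e' < delta by rewrite /e'; lra.
have ee' : e < gamma * e' by rewrite mulrC -ltr_pdivrMr// /e'; lra.
(* The vector found has norm at most [r / gamma], which is [rho / 2]. *)
pose r := rho * gamma / 2.
have r0 : 0 < r by rewrite !mulr_gt0.
have Nz i : N `|(z i).1| `|(z i).2| = 1 by rewrite -absum_normE z1.
have z11 i : `|(z i).1| <= 1 by rewrite -(Nz i) -{1}normr_id absnorm_ge1.
have z21 i : `|(z i).2| <= 1 by rewrite -(Nz i) -{1}normr_id absnorm_ge2.
have /choice[p pP] i := absnorm_support N _ _ (normr_ge0 _) (normr_ge0 _) (Nz i).
pose c i := (p i).1; pose d i := (p i).2.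
have c0 i : 0 <= c i by have [] := pP i.
have cd0 i : 0 <= d i by have [] := pP i.
have cd1 i : 1 <= c i + d i.
  have [_ _ _ _ [<- _]] := pP i.
  by apply: lerD; apply: ler_piMr => //; [exact: c0|exact: cd0].
have [u [ur su]] : exists u : X, `|u| <= r /\
    (\sum_i c i) * e' * r <= \sum_i c i * spread (z i).1 u.
  apply: (weighted_direction _ _ _ _ _ rX) => // [i zi|]; last by rewrite ltW.
  by have [_ _ + _ _] := pP i; apply; rewrite zi normr0.
have [v [vr sv]] : exists v : Y, `|v| <= r /\
    (\sum_i d i) * e' * r <= \sum_i d i * spread (z i).2 v.
  apply: (weighted_direction _ _ _ _ _ rY) => // [i zi|]; last by rewrite ltW.
  by have [_ _ _ + _] := pP i; apply; rewrite zi normr0.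
pose w : absum N X Y := (u, v).
have wr : `|w| <= r / gamma.
  rewrite absum_normE /=; apply: le_trans (absnorm_mono N _ ur _ vr) _ => //.
  have := absnormZ N r 1 1; rewrite mulr1 gtr0_norm// => ->.
  by rewrite ler_pM2l.
have sw i : c i * spread (z i).1 u + d i * spread (z i).2 v <= spread (z i) w.
  have [_ _ _ _ [pz pN]] := pP i.
  rewrite /spread z1 !absum_normE /=.
  have := pN `|(z i).1 + u| `|(z i).2 + v| (normr_ge0 _) (normr_ge0 _).
  have := pN `|(z i).1 - u| `|(z i).2 - v| (normr_ge0 _) (normr_ge0 _).
  rewrite -/(c i) -/(d i) in pz *; lra.
have total : n%:R * e' * r <= \sum_(i < n) spread (z i) w.
  apply: (@le_trans _ _ ((\sum_i (c i + d i)) * e' * r)).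
    rewrite ler_pM2r// ler_pM2r// -[X in X%:R]card_ord -sum1_card natr_sum.
    exact: ler_sum.
  apply: le_trans (ler_sum _ (fun i _ => sw i)).
  by rewrite !big_split /= !mulrDl lerD.
have w0 : w != 0.
  apply: contraTneq total => ->; rewrite -ltNge.
  rewrite big1 => [|i _]; last exact: spread_x0.
  by rewrite mulr_gt0 ?r0// mulr_gt0 ?e'0// ltr0n.
exists w; split => //.
  by apply: le_lt_trans wr _; rewrite /r mulrAC mulfK ?gt_eqF//; lra.
apply: lt_le_trans total.
apply: (@lt_le_trans _ _ (n%:R * (gamma * e') * `|w|)).
  by rewrite ltr_pM2r ?normr_gt0// ltr_pM2l// ltr0n.
apply: (@le_trans _ _ (n%:R * (gamma * e') * (r / gamma))).
  by rewrite ler_wpM2l// mulr_ge0// mulr_ge0// ltW.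
by rewrite le_eqVlt; apply/orP; left; apply/eqP; field; rewrite gt_eqF.
Qed.
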